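(* For every $\varepsilon>0$ there exist positive integers $d_\varepsilon,N_\varepsilon$ such that for all integers $d\ge d_\varepsilon$, $N\ge N_\varepsilon$, and every point $\mathbf a\in\mathcal W(d,N)$, the proportion of triangles $(\mathbf a,\mathbf w_1,\mathbf w_2)$ with $\mathbf w_1,\mathbf w_2\in\mathcal W(d,N)$ for which $$\Bigl|\operatorname{dist}_d(\mathbf w_1,\mathbf w_2)-\tfrac{1}{\sqrt6}\Bigr|\le\varepsilon\quad\text{and}\quad\Bigl|\operatorname{dist}_d(\mathbf a,\mathbf w_j)-\sqrt{\tfrac1{12}+r_{\mathbf a}^2}\Bigr|\le\varepsilon\ \text{ for } j=1,2$$ is at least $1-\varepsilon$, where $r_{\mathbf a}=\operatorname{dist}_d(\mathbf a,\mathbf c)$.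
   Context: For integers $d,N\ge1$, $\mathcal W(d,N)=\{0,1,\dots,N\}^d$ is the set of lattice points of $[0,N]^d$ and $\mathbf c=(N/2,\dots,N/2)$ its center. The normalized distance is $\operatorname{dist}_d(\mathbf u,\mathbf v)=\frac{1}{\sqrt d\,N}\bigl(\sum_{j=1}^d(u_j-v_j)^2\bigr)^{1/2}$. Triangles are counted as pairs $(\mathbf w_1,\mathbf w_2)\in\mathcal W^2$ forming with $\mathbf a$ a triangle. *)

(* Defs.v *)
From HB Require Import structures.
From mathcomp Require Import all_boot all_order all_algebra.
From mathcomp Require Import reals.

Set Implicit Arguments.
Unset Strict Implicit.
Unset Printing Implicit Defensive.

Import Order.TTheory GRing.Theory Num.Theory.
Local Open Scope ring_scope.

Definition lattice_cube (d N : nat) : finType := {ffun 'I_d -> 'I_N.+1}.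

Section Geometry.
Variables (R : realType) (d N : nat).

(* The center need not be a lattice point, so lattice points are embedded in
   R^d and distances are defined there. *)
Definition pt (w : lattice_cube d N) : 'rV[R]_d := \row_j (w j : nat)%:R.

Definition center : 'rV[R]_d := const_mx (N%:R / 2%:R).

Definition ndist (u v : 'rV[R]_d) : R :=
  (Num.sqrt d%:R * N%:R)^-1 * Num.sqrt (\sum_j (u 0 j - v 0 j) ^+ 2).

(* Three points form a triangle when they are not collinear, that is, when the
   two edge vectors issuing from u are linearly independent. *)
Definition is_triangle (u v w : 'rV[R]_d) : bool :=
  row_free (col_mx (v - u) (w - u)).

Definition triangles (a : lattice_cube d N) :
    {set lattice_cube d N * lattice_cube d N} :=
  [set p | is_triangle (pt a) (pt p.1) (pt p.2)].

Definition typical_triangle (eps : R) (a w1 w2 : lattice_cube d N) : bool :=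
  let r := ndist (pt a) center in
  [&& `|ndist (pt w1) (pt w2) - 1 / Num.sqrt 6%:R| <= eps,
      `|ndist (pt a) (pt w1) - Num.sqrt (1 / 12%:R + r ^+ 2)| <= eps &
      `|ndist (pt a) (pt w2) - Num.sqrt (1 / 12%:R + r ^+ 2)| <= eps].

Definition typical_proportion (eps : R) (a : lattice_cube d N) : R :=
  #|[set p in triangles a | typical_triangle eps a p.1 p.2]|%:R
    / #|triangles a|%:R.

End Geometry.

(* Main.v *)
Require Import Defs.
From HB Require Import structures.
From mathcomp Require Import all_boot all_order all_algebra.
From mathcomp Require Import reals.
From mathcomp Require Import ring lra zify.

Set Implicit Arguments.
Unset Strict Implicit.
Unset Printing Implicit Defensive.

Import Order.TTheory GRing.Theory Num.Theory.
Local Open Scope ring_scope.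

(** For a point [x] of the solid cube [0,N]^d, the squared distance from [x] to
    a uniformly random lattice point is an average of [d] independent terms in
    [0,1], with mean [1/12 + 1/(6N) + r_x^2]; by Chebyshev's inequality it
    deviates from it by more than [delta] with probability at most
    [1/(d delta^2)].  Using this at [x = a] for [w1] and for [w2], at [x = w1]
    for [w2], and at the center for [w1] (so that [r_{w1}^2] is close to [1/12])
    controls the three sides, since [|sqrt s - sqrt t|^2 <= |s - t|].
    Degenerate pairs only change the denominator: once [w1 <> a], at most [N+1]
    points [w2] are collinear with [a] and [w1], since each is determined by a
    coordinate in which [a] and [w1] differ; so for [d >= 3] at least half of
    all pairs form a triangle with [a]. *)

Section UniformDistribution.
Variables (R : realFieldType) (T : finType).
Implicit Types (f g : T -> R) (A B : {set T}).

Definition mean f : R := (\sum_x f x) / #|T|%:R.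

Definition variance f : R := mean (fun x => (f x - mean f) ^+ 2).

Definition density A : R := #|A|%:R / #|T|%:R.

Lemma eq_mean f g : f =1 g -> mean f = mean g.
Proof. by move=> fg; congr (_ / _); apply: eq_bigr. Qed.

Lemma meanZ c f : mean (fun x => c * f x) = c * mean f.
Proof. by rewrite /mean -mulr_sumr mulrA. Qed.

Lemma mean_sum (I : finType) (f : I -> T -> R) :
  mean (fun x => \sum_i f i x) = \sum_i mean (f i).
Proof. by rewrite /mean exchange_big mulr_suml. Qed.

Lemma ler_mean f g : (forall x, f x <= g x) -> mean f <= mean g.
Proof. by move=> fg; rewrite ler_wpM2r ?invr_ge0 ?ler_sum. Qed.

Lemma eq_variance f g : f =1 g -> variance f = variance g.
Proof. by move=> fg; apply: eq_mean => x; rewrite (eq_mean fg) fg. Qed.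

Lemma varianceZ c f : variance (fun x => c * f x) = c ^+ 2 * variance f.
Proof.
by rewrite /variance -meanZ meanZ; apply: eq_mean => x; rewrite -mulrBr exprMn.
Qed.

Lemma density_sub A B : A \subset B -> density A <= density B.
Proof.
by move=> sAB; rewrite ler_wpM2r ?invr_ge0 // ler_nat subset_leq_card.
Qed.

Lemma densityU A B : density (A :|: B) <= density A + density B.
Proof.
by rewrite -mulrDl -natrD ler_wpM2r ?invr_ge0 // ler_nat leq_card_setU.
Qed.

Lemma chebyshev f t : 0 < t ->
  density [set x | t < `|f x - mean f|] <= variance f / t ^+ 2.
Proof.
move=> t_gt0; rewrite ler_pdivlMr ?exprn_gt0 // mulrAC.
rewrite ler_wpM2r ?invr_ge0 // mulr_natl -sumr_const.
rewrite [leRHS](bigID [in [set x | t < `|f x - mean f|]]) /= ler_wpDr //.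
  by apply: sumr_ge0 => x _; exact: sqr_ge0.
apply: ler_sum => x; rewrite inE => /ltW dev_x.
by rewrite -[leRHS](real_normK (num_real _)) lerXn2r ?nnegrE // ltW.
Qed.

Lemma proportion_ge A (P : pred T) e :
    A != set0 -> density [set x | ~~ P x] <= e * density A ->
  1 - e <= #|[set x in A | P x]|%:R / #|A|%:R.
Proof.
rewrite -card_gt0 => A_gt0; have T_gt0 := leq_trans A_gt0 (max_card _).
rewrite mulrA ler_pM2r ?invr_gt0 ?ltr0n // ler_pdivlMr ?ltr0n // => nP_le.
have : (#|A| <= #|[set x in A | P x]| + #|[set x | ~~ P x]|)%N.
  apply: leq_trans (leq_card_setU _ _); apply/subset_leq_card/subsetP => x Ax.
  by rewrite !inE Ax orbN.
by rewrite -(ler_nat R) natrD; lra.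
Qed.

Hypothesis T_gt0 : (0 < #|T|)%N.

Lemma mean_cst c : mean (fun=> c) = c.
Proof.
by rewrite /mean sumr_const -[c *+ _]mulr_natr mulfK // pnatr_eq0 -lt0n.
Qed.

Lemma meanB_cst f c : mean (fun x => f x - c) = mean f - c.
Proof. by rewrite /mean sumrB mulrBl -/(mean (fun=> c)) mean_cst. Qed.

Lemma variance_unit_itv_le1 f : (forall x, 0 <= f x <= 1) -> variance f <= 1.
Proof.
move=> f01; rewrite -[leRHS]mean_cst; apply: ler_mean => x.
have mean_ge0 : 0 <= mean f.
  by rewrite -(mean_cst 0); apply: ler_mean => y; case/andP: (f01 y).
have mean_le1 : mean f <= 1.
  by rewrite -(mean_cst 1); apply: ler_mean => y; case/andP: (f01 y).
rewrite -(real_normK (num_real _)) exprn_ile1 // ler_norml.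
by have := f01 x; lra.
Qed.

End UniformDistribution.

Section ProductOfTwo.
Variables (R : realFieldType) (S T : finType).

Lemma card_dep_pairs (A : S -> {set T}) :
  #|[set p : S * T | p.2 \in A p.1]| = (\sum_x #|A x|)%N.
Proof.
rewrite -sum1_card; under [RHS]eq_bigr do rewrite -sum1_card.
by rewrite pair_big_dep; apply: eq_bigl => p; rewrite inE.
Qed.

Lemma density_dep_pairs (A : S -> {set T}) :
  density R [set p : S * T | p.2 \in A p.1] = mean (fun x => density R (A x)).
Proof.
by rewrite /density /mean card_dep_pairs card_prod -mulr_suml natr_sum natrM
  -mulrA invfM [(#|S|%:R)^-1 * _]mulrC.
Qed.

Lemma density_fst (A : {set S}) : (0 < #|T|)%N ->
  density R [set p : S * T | p.1 \in A] = density R A.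
Proof.
move=> T_gt0; have -> : [set p : S * T | p.1 \in A] = setX A setT.
  by apply/setP => p; rewrite !inE andbT.
by rewrite /density cardsX cardsT card_prod !natrM -mulf_div divff ?mulr1 //
  pnatr_eq0 -lt0n.
Qed.

End ProductOfTwo.

Section FunctionSpace.
Variables (R : realFieldType) (I S : finType).
Hypothesis S_gt0 : (0 < #|S|)%N.
Local Notation W := {ffun I -> S}.

Lemma mean_prod_ffun (P : pred I) (f : I -> S -> R) :
  mean (fun w : W => \prod_(i | P i) f i (w i)) = \prod_(i | P i) mean (f i).
Proof.
rewrite [RHS]big_mkcond /=.
pose F i s := if P i then f i s else 1.
transitivity (\prod_i mean (F i)); last first.
  by apply: eq_bigr => i _; rewrite /F; case: (P i) => //; rewrite mean_cst.
rewrite /mean prodf_div prodr_const bigA_distr_bigA card_ffun natrX.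
by congr (_ / _); apply: eq_bigr => w _; rewrite big_mkcond.
Qed.

Lemma mean_ffun_coord (f : S -> R) i : mean (fun w : W => f (w i)) = mean f.
Proof.
rewrite -(big_pred1_eq *%R i (fun=> mean f)) -mean_prod_ffun.
by apply: eq_mean => w; rewrite big_pred1_eq.
Qed.

Lemma mean_ffun_coord2 (f : I -> S -> R) i j : i != j ->
  mean (fun w : W => f i (w i) * f j (w j)) = mean (f i) * mean (f j).
Proof.
move=> neq_ij.
have pairE (F : I -> R) : \prod_(k in [set i; j]) F k = F i * F j.
  by rewrite big_setU1 ?inE // big_set1.
rewrite -(pairE (fun k => mean (f k))) -mean_prod_ffun.
by apply: eq_mean => w; rewrite pairE.
Qed.

Lemma mean_sum_ffun (f : I -> S -> R) :
  mean (fun w : W => \sum_i f i (w i)) = \sum_i mean (f i).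
Proof. by rewrite mean_sum; apply: eq_bigr => i _; rewrite mean_ffun_coord. Qed.

Lemma variance_sum_ffun (f : I -> S -> R) :
  variance (fun w : W => \sum_i f i (w i)) = \sum_i variance (f i).
Proof.
pose g i s := f i s - mean (f i).
have mean_g i : mean (g i) = 0 by rewrite meanB_cst // subrr.
rewrite /variance mean_sum_ffun.
transitivity (mean (fun w : W => \sum_i \sum_j g i (w i) * g j (w j))).
  apply: eq_mean => w; rewrite -sumrB expr2 mulr_suml.
  by apply: eq_bigr => i _; rewrite mulr_sumr.
rewrite mean_sum; apply: eq_bigr => i _; rewrite mean_sum (bigD1 i) //=.
rewrite big1 ?addr0 => [|j neq_ji].
  by rewrite -[RHS](mean_ffun_coord _ i); apply: eq_mean => w; rewrite expr2.
by rewrite mean_ffun_coord2 1?eq_sym // mean_g mul0r.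
Qed.

End FunctionSpace.

Lemma row_free_col_mx_rV (F : fieldType) m n (A : 'M[F]_(m, n)) (v : 'rV_n) :
  row_free (col_mx A v) = row_free A && ~~ (v <= A)%MS.
Proof.
rewrite /row_free -addsmxE; case: (boolP (v <= A)%MS) => [vA|nvA].
  rewrite andbF; apply/negbTE.
  by rewrite (addsmx_idPl vA) neq_ltn addn1 ltnS rank_leq_row.
suff -> : \rank (A + v) = (\rank A + 1)%N by rewrite andbT eqn_add2r.
apply/eqP; rewrite eqn_leq; apply/andP; split.
  by rewrite (leq_trans (mxrank_adds_leqif A v)) // leq_add2l rank_leq_row.
by rewrite addn1 rank_ltmx // /ltmx addsmxSl addsmx_sub submx_refl.
Qed.

Lemma sqrtr_dist_le (R : rcfType) (x y e : R) : 0 <= x -> 0 <= y -> 0 <= e ->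
  `|x - y| <= e ^+ 2 -> `|Num.sqrt x - Num.sqrt y| <= e.
Proof.
move=> x_ge0 y_ge0 e_ge0; rewrite -{1}(sqr_sqrtr x_ge0) -{1}(sqr_sqrtr y_ge0).
have := sqrtr_ge0 x; have := sqrtr_ge0 y.
move: (Num.sqrt x) (Num.sqrt y) => u v v_ge0 u_ge0 dist_le.
rewrite -(@ler_pXn2r _ 2) ?nnegrE //; apply: le_trans dist_le.
rewrite subr_sqr normrM expr2 ler_wpM2l // ger0_norm ?addr_ge0 //.
by rewrite ler_norml; lra.
Qed.

Section NormalizedDistance.
Variables (R : realType) (d N : nat).
Implicit Types u v w : 'rV[R]_d.

Lemma ndist_ge0 u v : 0 <= ndist N u v.
Proof. by rewrite mulr_ge0 ?invr_ge0 ?mulr_ge0 ?sqrtr_ge0. Qed.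

Lemma ndistxx u : ndist N u u = 0.
Proof.
rewrite /ndist big1 ?sqrtr0 ?mulr0 // => j _.
by rewrite subrr expr0n.
Qed.

Lemma ndistC u v : ndist N u v = ndist N v u.
Proof.
by congr (_ * Num.sqrt _); apply: eq_bigr => j _; rewrite -sqrrN opprB.
Qed.

Lemma sqr_ndist u v :
  ndist N u v ^+ 2 = d%:R^-1 * \sum_j ((u 0 j - v 0 j) / N%:R) ^+ 2.
Proof.
rewrite exprMn exprVn exprMn !sqr_sqrtr ?ler0n ?sumr_ge0 // => [|j _].
  under [in RHS]eq_bigr do rewrite expr_div_n.
  by rewrite -mulr_suml invfM mulrAC mulrA.
exact: sqr_ge0.
Qed.

Lemma ndist_sqrtr_le u v (s e : R) : 0 <= s -> 0 <= e ->
  `|ndist N u v ^+ 2 - s| <= e ^+ 2 -> `|ndist N u v - Num.sqrt s| <= e.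
Proof.
move=> s_ge0 e_ge0 close_s; rewrite -[ndist N u v]ger0_norm ?ndist_ge0 //.
by rewrite -(sqrtr_sqr (ndist N u v)) sqrtr_dist_le ?sqr_ge0.
Qed.

End NormalizedDistance.

Lemma sum_sqr_sub (R : realFieldType) N (t : R) :
  \sum_(s < N.+1) (t - s%:R) ^+ 2
    = N.+1%:R * (N%:R * (N%:R + 2) / 12 + (t - N%:R / 2) ^+ 2).
Proof.
elim: N => [|N IHN]; first by rewrite big_ord1 /=; field.
by rewrite big_ord_recr /= IHN -!natr1; field.
Qed.

Section Concentration.
Variables (R : realType) (d N : nat).
Hypotheses (d_gt0 : (0 < d)%N) (N_gt0 : (0 < N)%N).
Local Notation W := (lattice_cube d N).
Implicit Types (x : 'rV[R]_d) (w : W) (delta : R).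

Lemma card_lattice_cube : #|{: W}| = (N.+1 ^ d)%N.
Proof. by rewrite card_ffun !card_ord. Qed.

Lemma card_lattice_cube_gt0 : (0 < #|{: W}|)%N.
Proof. by rewrite card_lattice_cube expn_gt0. Qed.

Definition in_solid_cube x := forall j, 0 <= x 0 j <= N%:R.

Lemma pt_in_solid_cube w : in_solid_cube (pt R w).
Proof. by move=> j; rewrite mxE ler0n ler_nat -ltnS ltn_ord. Qed.

Lemma center_in_solid_cube : in_solid_cube (center R d N).
Proof. by move=> j; have N_ge0 : 0 <= N%:R :> R by []; rewrite mxE; lra. Qed.

Definition sqr_offset (t : R) (s : 'I_N.+1) : R := ((t - s%:R) / N%:R) ^+ 2.

Lemma mean_sqr_offset (t : R) :
  mean (sqr_offset t)
    = 1 / 12 + 1 / (6 * N%:R) + ((t - N%:R / 2) / N%:R) ^+ 2.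
Proof.
have N_neq0 : N%:R != 0 :> R by rewrite pnatr_eq0 -lt0n.
rewrite /mean card_ord; under eq_bigr do rewrite /sqr_offset expr_div_n.
rewrite -mulr_suml sum_sqr_sub.
by field; rewrite N_neq0 nat1r pnatr_eq0.
Qed.

Lemma variance_sqr_offset_le1 (t : R) : 0 <= t <= N%:R ->
  variance (sqr_offset t) <= 1.
Proof.
move=> /andP[t_ge0 t_leN]; apply: variance_unit_itv_le1 => [|s].
  by rewrite card_ord.
have s_ge0 : 0 <= s%:R :> R by [].
have s_leN : s%:R <= N%:R :> R by rewrite ler_nat -ltnS ltn_ord.
have N0 : 0 < N%:R :> R by rewrite ltr0n.
rewrite /sqr_offset sqr_ge0 -(real_normK (num_real _)) exprn_ile1 //.
by rewrite ler_norml ler_pdivlMr // ler_pdivrMr //; lra.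
Qed.

Definition sqr_ndist_to x w : R := ndist N x (pt R w) ^+ 2.

Lemma sqr_ndist_toE x w :
  sqr_ndist_to x w = d%:R^-1 * \sum_j sqr_offset (x 0 j) (w j).
Proof.
by rewrite /sqr_ndist_to sqr_ndist; under eq_bigr do rewrite mxE.
Qed.

Lemma mean_sqr_ndist_to x :
  mean (sqr_ndist_to x)
    = 1 / 12 + 1 / (6 * N%:R) + ndist N x (center R d N) ^+ 2.
Proof.
rewrite (eq_mean (sqr_ndist_toE x)) meanZ.
rewrite (mean_sum_ffun _ (fun j => sqr_offset (x 0 j))) ?card_ord //.
under eq_bigr do rewrite mean_sqr_offset.
have d_neq0 : d%:R != 0 :> R by rewrite pnatr_eq0 -lt0n.
rewrite big_split /= sumr_const card_ord mulrDr.
rewrite -[(_ + _) *+ d]mulr_natl mulKf // sqr_ndist.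
by under [in RHS]eq_bigr do rewrite mxE.
Qed.

Lemma variance_sqr_ndist_to_le x : in_solid_cube x ->
  variance (sqr_ndist_to x) <= d%:R^-1.
Proof.
move=> x_cube; rewrite (eq_variance (sqr_ndist_toE x)) varianceZ.
rewrite (variance_sum_ffun _ (fun j => sqr_offset (x 0 j))) ?card_ord //.
rewrite expr2 -mulrA ler_piMr ?invr_ge0 //.
rewrite mulrC ler_pdivrMr ?ltr0n // mul1r.
rewrite -[leRHS](_ : \sum_(j < d) 1 = _); last by rewrite sumr_const card_ord.
by apply: ler_sum => j _; exact: variance_sqr_offset_le1.
Qed.

Definition atypical delta x : {set W} :=
  [set w | delta < `|sqr_ndist_to x w - mean (sqr_ndist_to x)|].

Lemma density_atypical_le delta x : 0 < delta -> in_solid_cube x ->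
  density R (atypical delta x) <= (d%:R * delta ^+ 2)^-1.
Proof.
move=> delta_gt0 x_cube; apply: le_trans (chebyshev _ _) _ => //.
by rewrite [leRHS]invfM ler_wpM2r ?invr_ge0 ?sqr_ge0 ?variance_sqr_ndist_to_le.
Qed.

End Concentration.

Section Collinearity.
Variables (R : realType) (d N : nat).
Local Notation W := (lattice_cube d N).
Implicit Types u v w : 'rV[R]_d.

Lemma not_triangle_eq_line u v w j : v 0 j != u 0 j -> ~~ is_triangle u v w ->
  w = u + ((w 0 j - u 0 j) / (v 0 j - u 0 j)) *: (v - u).
Proof.
rewrite -subr_eq0 => neq_j.
have edge_neq0 : v - u != 0.
  by apply: contra neq_j => /eqP/rowP/(_ j); rewrite !mxE => ->.
rewrite /is_triangle row_free_col_mx_rV /row_free rank_rV edge_neq0 /= negbK.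
case/sub_rVP => c edgeE; rewrite -[LHS](subrK u) addrC edgeE.
congr (_ + _ *: _).
by have /rowP/(_ j) := edgeE; rewrite !mxE => ->; rewrite mulfK.
Qed.

Lemma pt_inj : injective (@pt R d N).
Proof.
move=> w w' /rowP eq_pt; apply/ffunP => j; apply/val_inj/eqP.
by rewrite -(eqr_nat R); move: (eq_pt j); rewrite !mxE => ->.
Qed.

Lemma card_not_triangle_le u v : v != u ->
  (#|[set w : W | ~~ is_triangle u v (pt R w)]| <= N.+1)%N.
Proof.
rewrite -subr_eq0 => /rV0Pn[j]; rewrite !mxE subr_eq0 => neq_j.
rewrite -[leqRHS]card_ord; apply: (@leq_card_in _ _ (fun w : W => w j)).
move=> w w'; rewrite !inE => /(not_triangle_eq_line neq_j) wE.
move=> /(not_triangle_eq_line neq_j) w'E eq_j.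
by apply: pt_inj; rewrite wE w'E !mxE eq_j.
Qed.

Lemma card_setC_triangles_le (a : W) :
  (#|~: triangles R a| <= #|{: W}| * N.+2)%N.
Proof.
pose collinear (w : W) :=
  [set w' : W | ~~ is_triangle (pt R a) (pt R w) (pt R w')].
have -> : ~: triangles R a = [set p | p.2 \in collinear p.1].
  by apply/setP => p; rewrite !inE.
rewrite card_dep_pairs (bigD1 a) //= mulnS leq_add ?max_card //.
apply: leq_trans (_ : \sum_(w | w != a) N.+1 <= _)%N.
  apply: leq_sum => w neq_wa.
  by rewrite card_not_triangle_le // (inj_eq pt_inj).
by rewrite sum_nat_const leq_mul2r max_card orbT.
Qed.

Lemma density_triangles_ge (a : W) : (2 < d)%N -> (0 < N)%N ->
  1 / 2 <= density R (triangles R a).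
Proof.
move=> d_gt2 N_gt0.
have cube_ge : (2 * N.+2 <= #|{: W}|)%N.
  rewrite card_lattice_cube (@leq_trans (N.+1 ^ 3)) ?leq_exp2l //.
  by rewrite !expnS expn0; nia.
have pairs_le : (#|{: W}| * #|{: W}| <= 2 * #|triangles R a|)%N.
  have := card_setC_triangles_le a; have := cardsC (triangles R a).
  by rewrite card_prod; nia.
have W_gt0 : 0 < #|{: W}|%:R :> R by rewrite ltr0n card_lattice_cube_gt0.
rewrite /density card_prod natrM ler_pdivlMr ?mulr_gt0 //.
by move: pairs_le; rewrite -(ler_nat R) !natrM; lra.
Qed.

End Collinearity.

Section TypicalTriangles.
Variables (R : realType) (d N : nat) (eps : R).
Hypotheses (d_gt2 : (2 < d)%N) (N_gt0 : (0 < N)%N) (eps_gt0 : 0 < eps).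
Hypothesis N_large : 1 / (6 * N%:R) <= eps ^+ 2 / 4.
Local Notation W := (lattice_cube d N).
Local Notation delta := (eps ^+ 2 / 4).
Local Notation c := (center R d N).

Lemma notin_atypical_typical_triangle (a w1 w2 : W) :
    w1 \notin atypical N delta (pt R a) ->
    w2 \notin atypical N delta (pt R a) ->
    w2 \notin atypical N delta (pt R w1) -> w1 \notin atypical N delta c ->
  typical_triangle eps a w1 w2.
Proof.
have d_gt0 : (0 < d)%N by exact: leq_trans d_gt2.
rewrite !inE -!leNgt !mean_sqr_ndist_to // ndistxx expr0n /= addr0.
rewrite /sqr_ndist_to [ndist N c _]ndistC.
have sixthE : 1 / Num.sqrt 6 = Num.sqrt (1 / 6) :> R by rewrite !div1r sqrtrV.
have r_ge0 := sqr_ge0 (ndist N (pt R a) c).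
have : 0 <= 1 / (6 * N%:R) :> R by rewrite divr_ge0 ?mulr_ge0.
move: N_large; set bias := 1 / (6 * N%:R) => bias_le bias_ge0.
rewrite !ler_distl => /andP[? ?] /andP[? ?] /andP[? ?] /andP[? ?].
rewrite /typical_triangle sixthE.
apply/and3P; split; apply: ndist_sqrtr_le;
  by [lra | exact: ltW | rewrite ler_distl; apply/andP; split; lra].
Qed.

Lemma density_not_typical_le (a : W) :
  density R [set p : W * W | ~~ typical_triangle eps a p.1 p.2]
    <= 4 * (d%:R * delta ^+ 2)^-1.
Proof.
set tail := (_ * _)^-1; pose B : 'rV[R]_d -> {set W} := atypical N delta.
have W_gt0 := card_lattice_cube_gt0 d N.
have B_le x : in_solid_cube N x -> density R (B x) <= tail.
  apply: density_atypical_le => //; first exact: leq_trans d_gt2.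
  by rewrite divr_gt0 ?exprn_gt0.
have snd_le (x : W -> 'rV[R]_d) : (forall w, in_solid_cube N (x w)) ->
    density R [set p : W * W | p.2 \in B (x p.1)] <= tail.
  move=> x_cube; rewrite (density_dep_pairs _ (fun w => B (x w))).
  by rewrite -[leRHS](mean_cst W_gt0); apply: ler_mean => w; exact: B_le.
have fst_le x : in_solid_cube N x ->
    density R [set p : W * W | p.1 \in B x] <= tail.
  by move=> x_cube; rewrite density_fst // B_le.
have cover : [set p : W * W | ~~ typical_triangle eps a p.1 p.2]
    \subset [set p : W * W | p.1 \in B (pt R a)]
        :|: [set p : W * W | p.2 \in B (pt R a)]
        :|: [set p : W * W | p.2 \in B (pt R p.1)]
        :|: [set p : W * W | p.1 \in B c].
  apply/subsetP => -[w1 w2]; rewrite !in_setU !(in_set _ (w1, w2)) /=.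
  apply: contraR; rewrite !negb_or -!andbA => /and4P[? ? ? ?].
  exact: notin_atypical_typical_triangle.
apply: le_trans (density_sub _ cover) _.
have -> : 4 * tail = tail + tail + tail + tail by ring.
do 3?[apply: le_trans (densityU _ _ _) _; apply: lerD].
- exact/fst_le/pt_in_solid_cube.
- by apply: (snd_le (fun=> pt R a)) => _; exact: pt_in_solid_cube.
- by apply: (snd_le (fun w => pt R w)) => w; exact: pt_in_solid_cube.
- exact/fst_le/center_in_solid_cube.
Qed.

Lemma typical_proportion_ge (a : W) : 128 <= eps ^+ 5 * d%:R ->
  1 - eps <= typical_proportion eps a.
Proof.
move=> d_large; have tri_ge := density_triangles_ge R a d_gt2 N_gt0.
apply: proportion_ge.
  by apply/eqP => tri0; move: tri_ge; rewrite tri0 /density cards0 mul0r; lra.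
apply: le_trans (density_not_typical_le a) _.
have d_gt0 : 0 < d%:R :> R by rewrite ltr0n (leq_trans _ d_gt2).
apply: le_trans (_ : eps * (1 / 2) <= _); last by rewrite ler_pM2l.
have delta_gt0 : 0 < delta by rewrite divr_gt0 ?exprn_gt0.
rewrite ler_pdivrMr; last by rewrite mulr_gt0 ?exprn_gt0.
have -> : eps * (1 / 2) * (d%:R * delta ^+ 2) = eps ^+ 5 * d%:R / 32 by field.
by lra.
Qed.

End TypicalTriangles.

Theorem theorem1p3 (R : realType) (eps : R) (eps_gt0 : 0 < eps) :
  exists d_eps N_eps : nat,
    [/\ (0 < d_eps)%N, (0 < N_eps)%N &
      forall d N : nat, (d_eps <= d)%N -> (N_eps <= N)%N ->
      forall a : lattice_cube d N,
        1 - eps <= typical_proportion eps a].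
Proof.
have truncn_ltW (x : R) n : (Num.truncn x < n)%N -> x <= n%:R.
  by case: n => // n; rewrite ltnS truncn_le_nat => /ltW.
exists (maxn 3 (Num.truncn (128 / eps ^+ 5)).+1), (Num.truncn (1 / eps ^+ 2)).+1.
split=> // [|d N]; first by rewrite leq_max.
rewrite geq_max => /andP[d_gt2 /truncn_ltW d_large] N_ge a.
have N_gt0 : (0 < N)%N by exact: leq_trans N_ge.
apply: typical_proportion_ge => //; last first.
  by move: d_large; rewrite ler_pdivrMr ?exprn_gt0 // mulrC.
have := truncn_ltW _ _ N_ge.
by rewrite !ler_pdivrMr ?mulr_gt0 ?exprn_gt0 ?ltr0n //; lra.
Qed.
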